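(* Let $\phi$ be a polygon with vertices $\phi(1),\dots,\phi(N)$ contained in a polyhedron $M$ with planar quadrilateral faces, let $\xi$ be its parallel Darboux vector field, and let $\sigma$ be the scalar function defined by $\xi(i+1)-\xi(i)=-\sigma(i+\tfrac12)\,(\phi(i+1)-\phi(i))$, $1\le i\le N-1$. Assume $\sigma(i+\tfrac12)\neq 0$ for all $i$. Let $O(i+\tfrac12)$ be the intersection point of the lines $x(i,\cdot)$ and $x(i+1,\cdot)$, and let $\mathcal{E}$ be the osculating developable polyhedron. Then the following statements are equivalent: (1) $\sigma(i+\tfrac12)$ does not depend on $i$. (2) The point $O(i+\tfrac12)$ does not depend on $i$. (3) $\mathcal{E}$ is a cone.
   Context: Setting: $M\subset\mathbb{R}^3$ is a polyhedron whose faces are planar (nondegenerate) quadrilaterals, and $\phi$ is a polygonal line with vertices $\phi(i)$, $1\le i\le N$, each of whose sides connects opposite edges of a face of $M$; each vertex $\phi(i)$ lies on an edge of $M$. The face of $M$ containing the side from $\phi(i)$ to $\phi(i+1)$ is denoted $T_{i+1/2}M$. For each $i$, $\xi(i)\neq 0$ is a vector in the direction of the edge of $M$ containing $\phi(i)$; it is transversal to the adjacent sides of $\phi$. Hence $\xi(i)$, $\xi(i+1)$ and $\phi(i+1)-\phi(i)$ are all parallel to the plane of $T_{i+1/2}M$. There is a choice of such vectors $\xi(i)$, unique up to a common multiplicative constant, for which $\xi(i+1)-\xi(i)$ is parallel to $\phi(i+1)-\phi(i)$ for every $i$; this is the parallel Darboux vector field of $\phi\subset M$. The line $x(i,u)=\phi(i)+u\xi(i)$,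 $u\in\mathbb{R}$, is the support line of the edge of $M$ containing $\phi(i)$. The lines $x(i,\cdot)$ and $x(i+1,\cdot)$ are coplanar and their intersection point is $$O(i+\tfrac12)=\phi(i)+\sigma^{-1}(i+\tfrac12)\xi(i)=\phi(i+1)+\sigma^{-1}(i+\tfrac12)\xi(i+1).$$ The osculating developable polyhedron $\mathcal{E}$ is the polyhedron whose face $i+\tfrac12$ is the region of the plane of $T_{i+1/2}M$ bounded by the lines $x(i,\cdot)$ and $x(i+1,\cdot)$ and containing the side of $\phi$ from $\phi(i)$ to $\phi(i+1)$. It is a cone if all the lines $x(i,\cdot)$, $1\le i\le N$, pass through one common point. *)

(* Defs.v *)
From mathcomp Require Import all_boot all_order all_algebra.
From mathcomp Require Import classical_sets reals.

Set Implicit Arguments.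
Unset Strict Implicit.
Unset Printing Implicit Defensive.

Import Order.TTheory GRing.Theory Num.Theory.

Local Open Scope classical_set_scope.
Local Open Scope ring_scope.

Section Geometry.
Variable R : realType.
Local Notation point := 'rV[R]_3.

Definition segment (p q : point) : set point :=
  [set x | exists2 t : R, 0 <= t <= 1 & x = (1 - t) *: p + t *: q].

Definition triangle (p q r : point) : set point :=
  [set x | exists a b c : R,
    [/\ 0 <= a, 0 <= b, 0 <= c, a + b + c = 1
      & x = a *: p + b *: q + c *: r]].

Definition line (p v : point) : set point :=
  [set x | exists u : R, x = p + u *: v].

Definition independent (u v : point) : Prop := row_free (col_mx u v).

(* [(u <= v)%MS] on row vectors means that u is a scalar multiple of v. *)
Definition edge_direction (e : set point) (v : point) : Prop :=
  v != 0 /\ forall p q, e p -> e q -> (q - p <= v)%MS.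

(* For a line l of the plane P and a point q of P outside l, this is the
   closed half-plane of P bounded by l and containing q. *)
Definition half_plane (P l : set point) (q : point) : set point :=
  [set x | P x /\ forall t : R, 0 < t < 1 -> ~ l ((1 - t) *: x + t *: q)].

(* The corners of a quadrilateral are listed in cyclic order; [quad_edge c k]
   joins corner k to corner k + 1 mod 4, so edges k and k + 2 are opposite. *)
Definition quad_edge (c : 'I_4 -> point) (k : 'I_4) : set point :=
  segment (c k) (c (ordS k)).

Definition opp_edge (k : 'I_4) : 'I_4 := ordS (ordS k).

Definition quad_spread (c : 'I_4 -> point) : 'M[R]_(4, 3) :=
  \matrix_(k < 4) (c k - c ord0).

Definition quad_plane (c : 'I_4 -> point) : set point :=
  [set x | (x - c ord0 <= quad_spread c)%MS].

(* The quadrilateral need not be convex. *)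
Record nondegenerate_planar_quad (c : 'I_4 -> point) : Prop := {
  quad_planar : (\rank (quad_spread c) <= 2)%N;
  quad_general : forall i j k : 'I_4, uniq [:: i; j; k] ->
    independent (c j - c i) (c k - c i);
  quad_simple : forall k : 'I_4,
    quad_edge c k `&` quad_edge c (opp_edge k) = set0 }.

(* Cutting along a diagonal gives the region enclosed by a simple quadrilateral
   when the diagonal is interior, and its convex hull otherwise. At least one
   diagonal is interior, so the region is the intersection of the two. *)
Definition quad_region (c : 'I_4 -> point) : set point :=
  let A := c (inord 0) in let B := c (inord 1) in
  let C := c (inord 2) in let D := c (inord 3) in
  (triangle A B C `|` triangle A C D) `&` (triangle A B D `|` triangle B C D).

(* A finite polyhedral surface, possibly with boundary. *)
Record quad_polyhedron := QuadPolyhedron {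
  face : finType;
  corner : face -> 'I_4 -> point;
  face_quad : forall f, nondegenerate_planar_quad (corner f);
  face_to_face : forall f g x, f != g ->
    quad_region (corner f) x -> quad_region (corner g) x ->
    (exists k l, corner f k = x /\ corner g l = x) \/
    (exists k l, quad_edge (corner f) k = quad_edge (corner g) l
                 /\ quad_edge (corner f) k x);
  edge_le2_faces : forall f g h k l m,
    quad_edge (corner f) k = quad_edge (corner g) l ->
    quad_edge (corner g) l = quad_edge (corner h) m ->
    ~~ uniq [:: f; g; h] }.

Section Polygon.
Variables (M : quad_polyhedron) (n : nat).

(* A polygonal line with N = n + 1 vertices has n sides; side i : 'I_n, which
   stands for the half-integer index, joins vertices i and i + 1. *)
Definition side_start (i : 'I_n) : 'I_n.+1 := widen_ord (leqnSn n) i.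
Definition side_end (i : 'I_n) : 'I_n.+1 := lift ord0 i.

(* [vertex_edge i] is the edge of M containing vertex i. It is part of the data
   because a vertex of the polygon may be a corner of M. *)
Record polygon_on := PolygonOn {
  vertex :> 'I_n.+1 -> point;
  vertex_edge : 'I_n.+1 -> set point;
  side_face : 'I_n -> face M;
  vertex_edgeP : forall i, exists f k,
    vertex_edge i = quad_edge (@corner M f) k;
  vertex_in_edge : forall i, vertex_edge i (vertex i);
  side_in_face : forall i,
    segment (vertex (side_start i)) (vertex (side_end i))
      `<=` quad_region (corner (side_face i));
  side_opposite : forall i, exists k,
    vertex_edge (side_start i) = quad_edge (corner (side_face i)) k /\
    vertex_edge (side_end i) = quad_edge (corner (side_face i)) (opp_edge k);
  side_transversal : forall i v,
    edge_direction (vertex_edge (side_start i)) v \/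
    edge_direction (vertex_edge (side_end i)) v ->
    independent v (vertex (side_end i) - vertex (side_start i)) }.

Record parallel_darboux (phi : polygon_on) (xi : 'I_n.+1 -> point) : Prop := {
  darboux_direction : forall i, edge_direction (vertex_edge phi i) (xi i);
  darboux_parallel : forall i,
    (xi (side_end i) - xi (side_start i)
       <= phi (side_end i) - phi (side_start i))%MS }.

Definition support_line (phi : polygon_on) (xi : 'I_n.+1 -> point)
  (i : 'I_n.+1) : set point := line (phi i) (xi i).

Record developable := Developable {
  ruling : 'I_n.+1 -> set point;
  developable_face : 'I_n -> set point }.

Definition osculating_developable (phi : polygon_on) (xi : 'I_n.+1 -> point) :
    developable :=
  let l := support_line phi xi in
  {| ruling := l;
     developable_face := fun i =>
       let P := quad_plane (corner (side_face phi i)) in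
       half_plane P (l (side_start i)) (phi (side_end i)) `&`
       half_plane P (l (side_end i)) (phi (side_start i)) |}.

Definition is_cone (E : developable) : Prop :=
  exists O : point, forall i, ruling E i O.

End Polygon.
End Geometry.

(* Main.v *)
Require Import Defs.
From mathcomp Require Import all_boot all_order all_algebra.
From mathcomp Require Import classical_sets reals.

(** The point [phi i + (sigma i)^-1 *: xi i] lies on both rulings of a side: this
is the defining relation of [sigma] divided by [sigma]. Hence each vertex [v]
of a side satisfies [O = phi v + sigma^-1 *: xi v] (lemma [rulings_meetE]).

Two consecutive sides share a vertex [v], so their points [O] lie on the same
line through [phi v], with parameters the inverses of their values of [sigma].
Since [xi v] is nonzero, the two points [O] agree exactly when the two values
of [sigma] agree (lemma [eq_point_on_line]). Propagating along the polygon gives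
the equivalence of (1) and (2).

A common point of all rulings lies on both rulings of every side, which meet
only at [O i], hence is [O i] for every [i]. Conversely, as every vertex belongs
to some side (lemma [vertex_on_side]), a constant [O] lies on all rulings. The
exception is a polygon reduced to one vertex, where the single ruling is a cone
for a trivial reason. *)

Set Implicit Arguments.
Unset Strict Implicit.
Unset Printing Implicit Defensive.

Import Order.TTheory GRing.Theory Num.Theory.

Local Open Scope classical_set_scope.
Local Open Scope ring_scope.

Lemma eq_of_consecutive (T : Type) (n : nat) (f : 'I_n -> T) :
  (forall i j : 'I_n, j = i.+1 :> nat -> f i = f j) ->
  forall i j : 'I_n, f i = f j.
Proof.
case: n f => [|n] f step; first by case.
suff f0 (j : 'I_n.+1) : f ord0 = f j by move=> i j; rewrite -f0.
case: j; elim=> [|m IHm] lt_m; first by congr f; apply: val_inj.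
by rewrite (IHm (ltnW lt_m)); apply: step.
Qed.

Lemma side_end_start (n : nat) (i j : 'I_n) :
  j = i.+1 :> nat -> side_end i = side_start j.
Proof. by move=> ij; apply: val_inj; rewrite /= ij. Qed.

Lemma vertex_on_side (n : nat) (v : 'I_n.+2) :
  exists i : 'I_n.+1, v = side_start i \/ v = side_end i.
Proof.
case: (unliftP ord0 v) => [i ->|->]; first by exists i; right.
by exists ord0; left; apply: val_inj.
Qed.

Lemma eq_point_on_line (K : fieldType) (V : lmodType K) (p v : V) (a b : K) :
  v != 0 -> (p + a^-1 *: v == p + b^-1 *: v) = (a == b).
Proof.
move=> v0; rewrite (inj_eq (addrI p)) -subr_eq0 -scalerBl scaler_eq0.
by rewrite (negPf v0) orbF subr_eq0 (inj_eq invr_inj).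
Qed.

(** At the parameter [s^-1], the displacement from [p] to [q] is cancelled by the
change of direction from [v] to [w], so this parameter gives the same point on
both lines; as they have a single common point, it is [x]. *)
Lemma rulings_meetE (R : realType) (p q v w x : 'rV[R]_3) (s : R) :
  s != 0 -> w - v = - (s *: (q - p)) -> line p v `&` line q w = [set x] ->
  x = p + s^-1 *: v /\ x = q + s^-1 *: w.
Proof.
move=> s0 wv meet.
have pq : p + s^-1 *: v = q + s^-1 *: w.
  rewrite -[w](subrK v) wv addrC scalerDr scalerN scalerA mulVf // scale1r.
  by rewrite addrA opprB [q + _]addrC subrK addrC.
have : (line p v `&` line q w) (p + s^-1 *: v).
  by split; exists s^-1.
by rewrite meet /= => <-.
Qed.

Theorem proposition3p1 (R : realType) (M : quad_polyhedron R) (n : nat)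
  (phi : polygon_on M n) (xi : 'I_n.+1 -> 'rV[R]_3)
  (hxi : parallel_darboux phi xi)
  (sigma : 'I_n -> R)
  (hsigma : forall i : 'I_n,
     xi (side_end i) - xi (side_start i) =
       - (sigma i *: (phi (side_end i) - phi (side_start i))))
  (sigma_neq0 : forall i : 'I_n, sigma i != 0)
  (O : 'I_n -> 'rV[R]_3)
  (hO : forall i : 'I_n,
     support_line phi xi (side_start i) `&` support_line phi xi (side_end i)
       = [set O i]) :
  [<-> forall i j : 'I_n, sigma i = sigma j;
       forall i j : 'I_n, O i = O j;
       is_cone (osculating_developable phi xi)].
Proof.
have OE i := rulings_meetE (sigma_neq0 i) (hsigma i) (hO i).
have step (i j : 'I_n) : j = i.+1 :> nat -> (O i == O j) = (sigma i == sigma j).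
  move=> ij; rewrite (OE i).2 (OE j).1 -(side_end_start ij) eq_point_on_line //.
  by case: (darboux_direction hxi (side_end i)).
have O_on i : (support_line phi xi (side_start i)
               `&` support_line phi xi (side_end i)) (O i) by rewrite hO.
tfae.
- move=> sigmaC; apply: eq_of_consecutive => i j ij.
  by apply/eqP; rewrite step //; apply/eqP.
- move=> OC; move: O_on OC; clear - phi xi O.
  case: n phi xi O => [|m] ph x Om.
    (* A polygon without sides has one ruling; any of its points will do. *)
    move=> _ _; exists (ph ord0) => v; exists 0.
    by rewrite scale0r addr0 (ord1 v).
  move=> Om_on OC; exists (Om ord0) => v.
  have [i [] ->] := vertex_on_side v; rewrite (OC _ i).
    exact: (Om_on i).1.
  exact: (Om_on i).2.
- move=> [apex apexP].
  have OC i : O i = apex.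
    have : (support_line phi xi (side_start i)
            `&` support_line phi xi (side_end i)) apex.
      by split; apply: apexP.
    by rewrite hO.
  by apply: eq_of_consecutive => i j ij; apply/eqP; rewrite -step // !OC.
Qed.
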